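(* Let $n\ge 2$ and let $X$ be a set of $n$ points in the plane $\mathbb{R}^2$ with the $L_1$ metric. If there is no universal line, i.e. no two distinct points $u,v\in X$ satisfy $\overline{uv}=X$, then $X$ induces at least $\lceil n/2\rceil$ lines, i.e. the family $\{\overline{uv} : u,v\in X,\ u\neq v\}$ of subsets of $X$ has at least $\lceil n/2\rceil$ distinct members.
   Context: The $L_1$ metric on $\mathbb{R}^2$ is $\rho((x_1,y_1),(x_2,y_2))=|x_1-x_2|+|y_1-y_2|$. For points of $X$, $z$ is between $x$ and $y$ if $x,y,z$ are distinct and $\rho(x,y)=\rho(x,z)+\rho(z,y)$. For distinct $u,v\in X$, the line $\overline{uv}$ is the subset of $X$ consisting of $u$, $v$ and all points $w\in X$ such that one of $u,v,w$ is between the other two. A line is universal if it equals $X$. *)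

(* Defs.v *)
From mathcomp Require Import all_boot all_order all_algebra.
From mathcomp Require Import finmap reals.

Set Implicit Arguments.
Unset Strict Implicit.
Unset Printing Implicit Defensive.

Import Order.TTheory GRing.Theory Num.Theory.

Local Open Scope fset_scope.
Local Open Scope ring_scope.

Section L1Lines.
Variable R : realType.
Implicit Types (p q u v w x y z : R * R) (X : {fset R * R}).

Definition l1dist p q : R := `|p.1 - q.1| + `|p.2 - q.2|.

(* [between z x y]: z lies between x and y. *)
Definition between z x y : bool :=
  [&& x != y, z != x, z != y & l1dist x y == l1dist x z + l1dist z y].

Definition line X u v : {fset R * R} :=
  [fset w in X | [|| w == u, w == v,
                     between w u v, between u v w | between v u w]].

(* A finite set of subsets of X, so coinciding lines are counted once. *)
Definition lines X : {fset {fset R * R}} :=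
  [fset line X p.1 p.2 | p in X `*` X & p.1 != p.2].

End L1Lines.

(* Main.v *)
(** Only the order of the coordinates matters, so they are replaced by their ranks, and [X] is cut
    into columns.  Let there be [k] columns, and call a point "third" if at least two points of its
    column lie below it.

    Vertical pairs: the line of a vertical pair misses exactly the points of the open horizontal
    strip between the two points that lie outside their column.  Without universal lines, this
    determines the pair, except that pairs of vertical neighbours in distinct columns may share a
    line.  Joining the lowest point of each column to the third points above it, and adding one pair
    of vertical neighbours, gives [t + 1] lines, where [t] is the number of third points.

    Oblique pairs: for each two consecutive columns choose a pair [(u, v)] across them with no point
    of the two columns at an intermediate height.  If the lines of two such pairs coincide, then the
    columns strictly between form a block all of whose points are in the same position relative
    to any point outside, and if such a line is vertical, the points off it fill a strip on one side.
    In both cases, replace [uv] by the line through [u] or [v] and a rightmost point [w] off [uv],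
    whose slope has the opposite sign.  The resulting [k - 1] lines are distinct and not vertical.

    Since [n <= 2 * k + t], the [k - 1 + t + 1] lines so obtained suffice.  If there is no vertical
    pair at all, then [n = k], and the [k - 1] oblique lines suffice. *)

From Stdlib Require Import ZArith Lia.
Require Import Defs.
From mathcomp Require Import all_boot all_order all_algebra.
From mathcomp Require Import finmap reals boolp lra.

Set Implicit Arguments.
Unset Strict Implicit.
Unset Printing Implicit Defensive.

Import Order.TTheory GRing.Theory Num.Theory.

Local Open Scope Z_scope.

(** * Betweenness and lines in integer coordinates *)

Definition zbetw (a c b : Z) := a <= c <= b \/ b <= c <= a.
Definition collinear (T : Type) (x y : T -> Z) (u v w : T) : Prop :=
  (zbetw (x u) (x w) (x v) /\ zbetw (y u) (y w) (y v)) \/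
  (zbetw (x u) (x v) (x w) /\ zbetw (y u) (y v) (y w)) \/
  (zbetw (x v) (x u) (x w) /\ zbetw (y v) (y u) (y w)).
Definition same_line (T : Type) (x y : T -> Z) (a b c d : T) : Prop :=
  forall s, collinear x y a b s <-> collinear x y c d s.
(** The line of such a pair is the union of two opposite closed quadrants with apexes [u] and
    [v]. *)
Definition adj (T : Type) (x y : T -> Z) (u v : T) : Prop :=
  x v = x u + 1 /\ y u <> y v /\
  forall s, (x s = x u /\ y s = y u) \/ (x s = x v /\ y s = y v) \/
    x s < x u \/ x v < x s \/ (y s < y u /\ y s < y v) \/ (y u < y s /\ y v < y s).

(** * Lines of increasing pairs and their replacements *)

Section Inc.
Variables (T : Type) (x y : T -> Z).
Implicit Types (u v w p q s z : T).
Notation collinear := (collinear x y).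
Notation same_line := (same_line x y).
Notation adj := (adj x y).

Definition sw s u := x s <= x u /\ y s <= y u.
Definition nw s u := x s <= x u /\ y u <= y s.

Lemma collinear_adj u v s : adj u v -> y u < y v ->
  collinear u v s <-> sw s u \/ sw v s.
Proof. move=> [h1 [_ h2]] h3; have := h2 s; rewrite /collinear /zbetw /sw; lia. Qed.

Lemma collinear_dec z w s : x z < x w -> y w < y z ->
  collinear z w s <-> nw s z \/ nw w s \/ (nw z s /\ nw s w).
Proof. by rewrite /collinear /zbetw /nw; lia. Qed.

Lemma collinear_inc z w s : x z < x w -> y z < y w ->
  collinear z w s <-> sw s z \/ sw w s \/ (sw z s /\ sw s w).
Proof. by rewrite /collinear /zbetw /sw; lia. Qed.

Lemma collinear_vert p q s : x p = x q -> y p < y q ->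
  collinear p q s <-> x s = x p \/ y s <= y p \/ y q <= y s.
Proof. by rewrite /collinear /zbetw; lia. Qed.

Definition strip p q s := y p < y s < y q.

(* The position of all points when an increasing [adj] pair [u], [v] and a vertical pair [p], [q] to
   its left span the same line; the last case describes the points off the line. *)
Definition vleft u v p q :=
  [/\ x p = x q, x p <= x u, y p < y q & y q <= y u] /\
  forall s, (sw s u /\ (x s = x p \/ ~ strip p q s)) \/
            (sw v s /\ ~ strip p q s) \/ (x v <= x s /\ strip p q s).

(** The image of [vleft] under a half-turn. Under [vleft], all points in columns up to that of [u]
    are south-west of [u]; under [vright], all points in columns from that of [v] on are north-east
    of [v]. *)
Definition vright u v p q :=
  [/\ x p = x q, x v <= x p, y p < y q & y v <= y p] /\
  forall s, (sw v s /\ (x s = x p \/ ~ strip p q s)) \/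
            (sw s u /\ ~ strip p q s) \/ (x s <= x u /\ strip p q s).

(* The position of all points when two increasing [adj] pairs span the same line: the columns from
   [v] to [u'] form a block with corners [v] and [u'], and the last two cases, collected in [corner],
   describe the points off the line. *)
Definition block u v u' v' :=
  [/\ x v <= x u', y v <= y u' & y u' < y v'] /\
  forall s, sw s u \/ sw v' s \/ (sw v s /\ sw s u') \/
            (x s <= x u /\ y u' < y s) \/ (x v' <= x s /\ y s < y v).

Lemma collinear_refl1 u v : collinear u v u. Proof. by rewrite /collinear /zbetw; lia. Qed.

Lemma collinear_refl2 u v : collinear u v v. Proof. by rewrite /collinear /zbetw; lia. Qed.

Lemma vleftP u v p q : adj u v -> y u < y v -> x p = x q -> y p < y q -> x p <= x u ->
  same_line u v p q -> vleft u v p q.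
Proof.
move=> a h e l lx sl; have := collinear_refl2 p q; have := collinear_refl1 p q.
rewrite -!(sl _) !collinear_adj // /sw => hp hq.
have [a1 _] := a; split; first by split; lia.
move=> s; have := sl s; rewrite collinear_adj // collinear_vert // /sw /strip.
have [_ [_ /(_ s)]] := a; lia.
Qed.

Lemma vrightP u v p q : adj u v -> y u < y v -> x p = x q -> y p < y q -> x v <= x p ->
  same_line u v p q -> vright u v p q.
Proof.
move=> a h e l lx sl; have := collinear_refl2 p q; have := collinear_refl1 p q.
rewrite -!(sl _) !collinear_adj // /sw => hp hq.
have [a1 _] := a; split; first by split; lia.
move=> s; have := sl s; rewrite collinear_adj // collinear_vert // /sw /strip.
have [_ [_ /(_ s)]] := a; lia.
Qed.

Lemma blockP u v u' v' : adj u v -> y u < y v -> adj u' v' -> x u < x u' ->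
  same_line u v u' v' -> block u v u' v'.
Proof.
move=> a h a' lx sl.
have [a1 _] := a; have [a1' [ne _]] := a'.
(* Both [u'] and [v'] are north-east of [v], so the line of a descending pair [u'v'] would miss
   [u]. *)
have h' : y u' < y v'.
  have := collinear_refl1 u' v'; have := collinear_refl2 u' v';
    rewrite -!(sl _) !collinear_adj // /sw => h1 h2.
  have := collinear_refl1 u v; rewrite (sl _).
  rewrite /collinear /zbetw; lia.
have := collinear_refl1 u' v'; rewrite -!(sl _) !collinear_adj // /sw => h1.
split; first by split; lia.
move=> s; have := sl s; rewrite !collinear_adj // /sw; lia.
Qed.

Lemma collinear_adj_dec u v s : adj u v -> y v < y u ->
  collinear u v s <-> nw s u \/ nw v s.
Proof. move=> [h1 [_ h2]] h3; have := h2 s; rewrite /collinear /zbetw /nw; lia. Qed.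

Lemma collinear_dec_sym z w s : x w < x z -> y z < y w ->
  collinear z w s <-> nw s w \/ nw z s \/ (nw w s /\ nw s z).
Proof. by rewrite /collinear /zbetw /nw; lia. Qed.

Lemma collinear_inc_sym z w s : x w < x z -> y w < y z ->
  collinear z w s <-> sw s w \/ sw z s \/ (sw w s /\ sw s z).
Proof. by rewrite /collinear /zbetw /sw; lia. Qed.

Definition strict_inc z w := (x z < x w /\ y z < y w) \/ (x w < x z /\ y w < y z).
Definition strict_dec z w := (x z < x w /\ y w < y z) \/ (x w < x z /\ y z < y w).

Definition rectangle_corners z w z' w' :=
  ((x z' = x z /\ x w' = x w /\ y z' = y w /\ y w' = y z) \/
   (x z' = x w /\ x w' = x z /\ y z' = y z /\ y w' = y w)).

(** Testing the endpoints of each pair against the line of the other leaves only the two diagonals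
    of a rectangle. *)
Lemma crossing_lines_corners z w z' w' : strict_inc z w -> strict_dec z' w' ->
  same_line z w z' w' -> rectangle_corners z w z' w'.
Proof.
move=> d i sl.
have := collinear_refl1 z w; have := collinear_refl2 z w; have := collinear_refl1 z' w';
  have := collinear_refl2 z' w'.
rewrite (sl z) (sl w) -(sl z') -(sl w').
rewrite /rectangle_corners.
case: d => -[d1 d2]; case: i => -[i1 i2];
 rewrite ?(collinear_dec _ i1 i2) ?(collinear_dec_sym _ i1 i2) ?(collinear_inc _ d1 d2)
   ?(collinear_inc_sym _ d1 d2) /sw /nw; lia.
Qed.

(** Of [u] and [v], only [u] is on the replacement line. A descending pair from another column that
    separates them would put a point left of [v] and above [u], which [vleft] excludes. *)
Lemma vleft_plain u v p q w u' v' : adj u v -> y u < y v -> vleft u v p q ->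
  x v <= x w -> strip p q w -> adj u' v' -> x u' <> x u -> ~ same_line u w u' v'.
Proof.
move=> a h [[e lx l lu] V] lw sw' a' nx sl.
have [a1 _] := a; have [a1' [ne c]] := a'.
rewrite /strip in sw'.
case: (Z.lt_ge_cases (y u') (y v')) => [h'|h'].
  have: rectangle_corners u' v' u w.
    by apply: crossing_lines_corners; rewrite /strict_inc /strict_dec; [lia|lia|move=> s; rewrite -sl].
  have := c u; rewrite /rectangle_corners; lia.
have D : forall s, collinear u w s <-> nw s u \/ nw w s \/ (nw u s /\ nw s w) by move=> s;
  apply: collinear_dec; lia.
have D' : forall s, collinear u' v' s <-> nw s u' \/ nw v' s by move=> s;
  apply: collinear_adj_dec => //; lia.
have Du : nw u u' \/ nw v' u by rewrite -D' -sl; apply: collinear_refl1.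
have Dv : ~ (nw v u' \/ nw v' v) by rewrite -D' -sl D /nw; lia.
have := V u'; have := V v'.
rewrite /nw /sw /strip in Du Dv *; lia.
Qed.

Definition corner u v u' v' w := (x w <= x u /\ y u' < y w) \/ (x v' <= x w /\ y w < y v).

Lemma collinear_sdec z w s : strict_dec z w ->
  collinear z w s <-> (nw s z /\ nw s w) \/ (nw z s /\ nw w s) \/ (nw z s /\ nw s w) \/ (nw w s
    /\ nw s z).
Proof. by rewrite /collinear /zbetw /nw /strict_dec; lia. Qed.

(** The replacement line contains [v] but neither [u] nor [v']. This forces a descending pair [ab]
    into the block, and then its line misses the lower left corner [v]. *)
Lemma block_plain u v u' v' w a b : adj u v -> y u < y v -> adj u' v' ->
  block u v u' v' -> corner u v u' v' w -> adj a b ->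
  x a <> x u -> x a <> x u' -> ~ same_line v w a b.
Proof.
move=> ad h ad' [[lx l1 l2] B] cw aab n1 n2 sl.
have [a1 _] := ad; have [a1' _] := ad'; have [b1 [ne c]] := aab.
rewrite /sw in B.
have sd : strict_dec v w by rewrite /corner in cw; rewrite /strict_dec; lia.
case: (Z.lt_ge_cases (y a) (y b)) => [h'|h'].
  have: rectangle_corners a b v w.
    by apply: crossing_lines_corners => //; [rewrite /strict_inc; lia|move=> s; rewrite sl].
  have := B a; have := B b; rewrite /rectangle_corners /corner in cw *; lia.
have D : forall s, collinear a b s <-> nw s a \/ nw b s by move=> s;
  apply: collinear_adj_dec => //; lia.
have Dv : nw v a \/ nw b v by rewrite -D -sl; apply: collinear_refl1.
have Du : ~ (nw u a \/ nw b u) by rewrite -D -sl (collinear_sdec _ sd) /nw;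
  rewrite /corner in cw; lia.
have Dv' : ~ (nw v' a \/ nw b v') by rewrite -D -sl (collinear_sdec _ sd) /nw;
  rewrite /corner in cw; lia.
rewrite /nw in Du Dv Dv'.
case: (Z.lt_ge_cases (x a) (x u)) => [l|l]; first by lia.
case: (Z.lt_ge_cases (x u') (x a)) => [l'|l']; first by rewrite /corner in cw; lia.
have := collinear_refl1 a b; have := collinear_refl2 a b;
  rewrite -!sl !(collinear_sdec _ sd) /nw => ha hb.
have Ba : x v <= x a <= x u' /\ y v <= y a <= y u' by have := B a; rewrite /corner in cw; lia.
have Bb : x v <= x b <= x u' /\ y v <= y b <= y u' by have := B b; rewrite /corner in cw; lia.
have := c v; rewrite /corner in cw; lia.
Qed.

(** * Replacement lines against each other and against vertical lines *)

Definition rightmost u v w := forall s, sw s u \/ sw v s \/ x s <= x w.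

(** Here and in the other combinations of kinds, endpoints of one replacement line are located by
    means of the other line, until a point violates one of the patterns [V], [B]. *)
Lemma vleft_vleft u v p q w u' v' p' q' w' :
  adj u v -> y u < y v -> vleft u v p q -> x v <= x w -> strip p q w ->
  adj u' v' -> y u' < y v' -> vleft u' v' p' q' -> x v' <= x w' -> strip p' q' w' ->
  x u < x u' -> ~ same_line u w u' w'.
Proof.
move=> [a1 _] h [[e lx l lu] V] lw sw1 [a1' _] h' [[e' lx' l' lu'] V'] lw' sw1' lt sl.
rewrite /strip in sw1 sw1' V V'.
have := collinear_refl1 u' w'; rewrite -sl collinear_dec /nw; [|lia|lia].
have := V' v; rewrite /sw; lia.
Qed.

Lemma vleft_vright u v p q w u' v' p' q' w' :
  adj u v -> y u < y v -> vleft u v p q -> x v <= x w -> strip p q w ->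
  adj u' v' -> y u' < y v' -> vright u' v' p' q' -> x w' <= x u' -> strip p' q' w' ->
  rightmost u' v' w' -> x u < x u' -> ~ same_line u w v' w'.
Proof.
move=> [a1 _] h [[e lx l lu] V] lw sw1 [a1' _] h' [[e' lx' l' lu'] V'] lw' sw1' R lt sl.
rewrite /strip /sw in sw1 sw1' V V'.
have v'w : nw u v' \/ nw w v' \/ (nw u v' /\ nw v' w).
  by have := collinear_refl1 v' w'; rewrite -sl collinear_dec /nw; lia.
(* As [v'] is no higher than [u], the point [v] is off the line [u'v'], so [w'] is at least as far
   right. *)
have Rv : x v <= x w' by have := R v; rewrite /sw /nw in v'w *; lia.
have : collinear u w w' by rewrite sl; apply: collinear_refl2.
have : ~ collinear v' w' v by rewrite -sl collinear_dec /nw; lia.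
rewrite collinear_sdec ?collinear_dec /strict_dec; rewrite /nw in v'w *; lia.
Qed.

Lemma vright_vleft u v p q w u' v' p' q' w' :
  adj u v -> y u < y v -> vleft u v p q -> x v <= x w -> strip p q w ->
  adj u' v' -> y u' < y v' -> vright u' v' p' q' -> x w' <= x u' -> strip p' q' w' ->
  x u' < x u -> ~ same_line u w v' w'.
Proof.
move=> [a1 _] h [[e lx l lu] V] lw sw1 [a1' _] h' [[e' lx' l' lu'] V'] lw' sw1' lt sl.
rewrite /strip /sw in sw1 sw1' V V'.
have v'w : collinear u w v' by rewrite sl; apply: collinear_refl1.
rewrite collinear_dec /nw in v'w; [|lia|lia].
have := V v'; have := V' w; have := V' q; have := V' p; lia.
Qed.

Lemma vleft_block u v p q w u' v' b b' w' :
  adj u v -> y u < y v -> vleft u v p q -> x v <= x w -> strip p q w ->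
  adj u' v' -> y u' < y v' -> adj b b' -> block u' v' b b' -> corner u' v' b b' w' ->
  rightmost u' v' w' -> x u < x u' -> ~ same_line u w v' w'.
Proof.
move=> [a1 _] h [[e lx l lu] V] lw sw1 [a1' _] h' [b1 _] [[lb l1 l2] B] cw R lt sl.
rewrite /strip /sw in sw1 V B; rewrite /corner in cw.
have sd : strict_dec v' w' by rewrite /strict_dec; lia.
have v'w : collinear u w v' by rewrite sl; apply: collinear_refl1.
rewrite collinear_dec /nw in v'w; [|lia|lia].
have Rv : x v <= x w' by have := R v; rewrite /sw; lia.
have : collinear u w w' by rewrite sl; apply: collinear_refl2.
have : ~ collinear v' w' v by rewrite -sl collinear_dec /nw; lia.
by rewrite (collinear_sdec _ sd) collinear_dec /nw; lia.
Qed.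

Lemma block_vright u v u' v' w a b p q t : adj u v -> y u < y v -> adj u' v' ->
  block u v u' v' -> corner u v u' v' w ->
  adj a b -> y a < y b -> vright a b p q -> x t <= x a -> strip p q t ->
  x a < x u -> ~ same_line v w b t.
Proof.
move=> [a1 _] h [b1 _] [[lb l1 l2] B] cw [c1 _] h' [[e lx l l'] V] lt st ll sl.
rewrite /strip /sw in st V B; rewrite /corner in cw.
have : collinear b t v by rewrite -sl; apply: collinear_refl1.
rewrite collinear_sdec /strict_dec /nw; last by lia.
have := V v; have := B b; lia.
Qed.

(** The premise ending in [b = v'] stands for the family having one pair per column. It serves to
    show that [ab] starts to the right of the block. *)
Lemma vright_block u v u' v' w a b p q t : adj u v -> y u < y v -> adj u' v' ->
  block u v u' v' -> corner u v u' v' w ->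
  adj a b -> y a < y b -> vright a b p q -> x t <= x a -> strip p q t ->
  rightmost a b t -> (x a = x u' -> b = v') ->
  x u < x a -> ~ same_line v w b t.
Proof.
move=> [a1 _] h [b1 _] [[lb l1 l2] B] cw [c1 _] h' [[e lx l l'] V] lt st R E ll sl.
rewrite /strip /sw in st V B; rewrite /corner in cw.
have sd : strict_dec v w by rewrite /strict_dec; lia.
have bt : strict_dec b t by rewrite /strict_dec; lia.
have hv : collinear b t v by rewrite -sl; apply: collinear_refl1.
rewrite (collinear_sdec _ bt) /nw in hv.
have vb : y b < y v by have := V v; have := B b; lia.
have ub : x v' <= x a.
  case: (Z.eq_dec (x a) (x u')) => [/E bv'|ne]; first by move: bv' vb => ->; lia.
  by have := B b; lia.
have hb : collinear v w b by rewrite sl; apply: collinear_refl1.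
have ht : collinear v w t by rewrite sl; apply: collinear_refl2.
have hv' : ~ collinear b t v' by rewrite -sl (collinear_sdec _ sd) /nw; lia.
rewrite !(collinear_sdec _ bt) !(collinear_sdec _ sd) /nw in hb ht hv'.
have := R v'; rewrite /sw.
lia.
Qed.

Lemma block_block u v u' v' w a b a' b' t : adj u v -> y u < y v -> adj u' v' ->
  block u v u' v' -> corner u v u' v' w ->
  adj a b -> y a < y b -> adj a' b' -> block a b a' b' -> corner a b a' b' t ->
  rightmost a b t -> (x a = x u' -> b = v') ->
  x u < x a -> ~ same_line v w b t.
Proof.
move=> [a1 _] h [b1 _] [[lb l1 l2] B] cw [c1 _] h' [d1 _] [[lb' l1' l2'] B'] ct R E ll sl.
rewrite /sw in B B'; rewrite /corner in cw ct.
have sd : strict_dec v w by rewrite /strict_dec; lia.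
have bt : strict_dec b t by rewrite /strict_dec; lia.
have hb : collinear v w b by rewrite sl; apply: collinear_refl1.
rewrite (collinear_sdec _ sd) /nw in hb.
have vb : y b < y v by have := B' v; lia.
have ub : x v' <= x a.
  case: (Z.eq_dec (x a) (x u')) => [/E bv'|ne]; first by move: bv' vb => ->; lia.
  by have := B b; lia.
have hv : collinear b t v by rewrite -sl; apply: collinear_refl1.
have ht : collinear v w t by rewrite sl; apply: collinear_refl2.
have hv' : ~ collinear b t v' by rewrite -sl (collinear_sdec _ sd) /nw; lia.
rewrite !(collinear_sdec _ bt) !(collinear_sdec _ sd) /nw in ht hv' hv.
have := R v'; rewrite /sw.
lia.
Qed.

(** This is where precedence of [left_vertical] matters: equal lines would put [u] into the block
    and [p] to the left of [v'], and then [pq] would span the line of [u'v'] too. *)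
Lemma block_vleft u v p q w u' v' b b' w' :
  adj u v -> y u < y v -> vleft u v p q -> x v <= x w -> strip p q w ->
  adj u' v' -> y u' < y v' -> adj b b' -> block u' v' b b' -> corner u' v' b b' w' ->
  (x u = x b -> v = b') ->
  (x p <= x u' -> ~ same_line u' v' p q) -> x u' < x u -> ~ same_line u w v' w'.
Proof.
move=> [a1 _] h [[e lx l lu] V] lw sw1 ad' h' [b1 _] [[lb l1 l2] B] cw E NL lt sl.
have [a1' _] := ad'.
rewrite /strip /sw in sw1 V B; rewrite /corner in cw.
have v'w : collinear u w v' by rewrite sl; apply: collinear_refl1.
rewrite collinear_dec /nw in v'w; [|lia|lia].
have v'u : y v' <= y u by have := V v'; lia.
have Su : x u <= x b /\ y v' <= y u <= y b by have := B u; lia.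
have Cp : x p <= x u' by have := B p; lia.
apply: (NL Cp) => s; rewrite (collinear_adj _ ad' h') (collinear_vert _ e l) /sw.
have qu : y q <= y u' by have := B q; lia.
have sv : y v' < y v by lia.
have := B s; have := V s.
case: (Z.eq_dec (x u) (x b)) => [/E vb'|ne].
  by rewrite vb' in V a1 sv h *; lia.
have := B v; lia.
Qed.

Lemma vright_vright u v p q w u' v' w' :
  adj u v -> y u < y v -> vright u v p q -> x w <= x u -> strip p q w ->
  adj u' v' -> y u' < y v' -> x u < x u' -> ~ same_line v w v' w'.
Proof.
move=> [a1 _] h [[e lx l lu] V] lw st [b1 _] h' lt sl.
rewrite /strip in st V.
have sd : strict_dec v w by rewrite /strict_dec; lia.
have := collinear_refl1 v' w'; rewrite -sl (collinear_sdec _ sd).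
have := V v'; have := V u'; rewrite /nw /sw; lia.
Qed.

Lemma vright_plain u v p q w u' v' : adj u v -> y u < y v -> vright u v p q ->
  x w <= x u -> strip p q w -> adj u' v' -> x u' <> x u -> ~ same_line v w u' v'.
Proof.
move=> a h [[e lx l lu] V] lw sw' a' nx sl.
have [a1 _] := a; have [a1' [ne c]] := a'.
rewrite /strip in sw' V.
have sd : strict_dec v w by rewrite /strict_dec; lia.
case: (Z.lt_ge_cases (y u') (y v')) => [h'|h'].
  have: rectangle_corners u' v' v w.
    by apply: crossing_lines_corners => //; rewrite /strict_inc; [lia|move=> s; rewrite -sl].
  have := c v; rewrite /rectangle_corners; lia.
have D' : forall s, collinear u' v' s <-> nw s u' \/ nw v' s by move=> s;
  apply: collinear_adj_dec => //; lia.
have Dv : nw v u' \/ nw v' v by rewrite -D' -sl; apply: collinear_refl1.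
have Du : ~ (nw u u' \/ nw v' u) by rewrite -D' -sl (collinear_sdec _ sd) /nw; lia.
have := V u'; have := V v'.
rewrite /nw /sw in Du Dv *; lia.
Qed.

(** Since [p] is off the replacement line, it would be strictly between [p'] and [q'] in height.
    Then [p'] is lower than [p], where the replacement line has no points. *)
Lemma vleft_vertical u v p q w p' q' : adj u v -> y u < y v -> vleft u v p q ->
  x v <= x w -> strip p q w -> x p' = x q' -> y p' < y q' -> ~ same_line u w p' q'.
Proof.
move=> [a1 _] h [[e lx l lu] V] lw st e' l' sl; rewrite /strip /sw in V st.
have D s : collinear u w s <-> nw s u \/ nw w s \/ (nw u s /\ nw s w) by apply: collinear_dec; lia.
have : ~ collinear p' q' p by rewrite -sl D /nw; lia.
have := collinear_refl1 p' q'; rewrite -sl D (collinear_vert _ e' l') /nw.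
have := V p'; lia.
Qed.

Lemma vright_vertical u v p q w p' q' : adj u v -> y u < y v -> vright u v p q ->
  x w <= x u -> strip p q w -> x p' = x q' -> y p' < y q' -> ~ same_line v w p' q'.
Proof.
move=> [a1 _] h [[e lx l lu] V] lw st e' l' sl; rewrite /strip /sw in V st.
have sd : strict_dec v w by rewrite /strict_dec; lia.
have D := collinear_sdec _ sd.
have : ~ collinear p' q' q by rewrite -sl D /nw; lia.
have := collinear_refl2 p' q'; rewrite -sl D (collinear_vert _ e' l') /nw.
have := V q'; lia.
Qed.

(** The points [u] and [v'] are off the replacement line, so the strip of [pq] contains them and
    also [v], whose height is between. As [v] is on the line, [p] is in its column and below [u],
    where the block pattern leaves no point. *)
Lemma block_vertical u v u' v' w p q : adj u v -> y u < y v -> adj u' v' ->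
  block u v u' v' -> corner u v u' v' w -> x p = x q -> y p < y q -> ~ same_line v w p q.
Proof.
move=> [a1 _] h [b1 _] [[lb l1 l2] B] cw e l sl; rewrite /sw /corner in B cw.
have sd : strict_dec v w by rewrite /strict_dec; lia.
have D := collinear_sdec _ sd.
have : ~ collinear p q u by rewrite -sl D /nw; lia.
have : ~ collinear p q v' by rewrite -sl D /nw; lia.
have : collinear p q v by rewrite -sl; apply: collinear_refl1.
rewrite !(collinear_vert _ e l); have := B p; lia.
Qed.

End Inc.

(** * The family of chosen oblique pairs and its replacements *)

Section Family.
Variables (T : Type) (x y : T -> Z) (fam : T -> T -> Prop).
Implicit Types (u v w p q s z : T).

Definition left_vertical u v :=
  exists p q, [/\ x p = x q, y p <> y q, x p <= x u & same_line x y u v p q].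
Definition right_vertical u v :=
  exists p q, [/\ x p = x q, y p <> y q, x v <= x p & same_line x y u v p q].
(** Asymmetric on purpose: the last of the pairs with a common line is not collapsed. *)
Definition collapsed u v :=
  exists u' v', [/\ fam u' v', x u < x u' & same_line x y u v u' v'].
Definition farthest u v w := ~ collinear x y u v w /\ forall s, collinear x y u v s \/ x s <= x w.
(* The case [left_vertical] must take precedence: otherwise the same replacement could arise from
   a collapsed pair and from the last pair with the same line. *)
Definition replaced u v z w := farthest u v w /\
  (left_vertical u v /\ z = u \/
   [/\ ~ left_vertical u v, collapsed u v \/ right_vertical u v & z = v]).

Hypothesis fam_adj : forall u v, fam u v -> adj x y u v.
Hypothesis fam_fun : forall u v u' v', fam u v -> fam u' v' -> x u = x u' -> u = u' /\ v = v'.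

Definition left_data u v z w := exists p q,
  [/\ z = u, vleft x y u v p q, x v <= x w & strip y p q w].
Definition right_data u v w := exists p q,
  [/\ vright x y u v p q, x w <= x u & strip y p q w].
Definition block_data u v w := exists u' v',
  [/\ fam u' v', x u < x u', same_line x y u v u' v', block x y u v u' v' & corner x y u v u' v' w].
Definition inc_data u v z w := y u < y v /\ ~ collinear x y u v w /\
  (left_data u v z w \/
   [/\ z = v, ~ left_vertical u v, rightmost x y u v w & block_data u v w \/ right_data u v w]).

Lemma collinear_sym u v s : collinear x y u v s <-> collinear x y v u s.
Proof. by rewrite /collinear /zbetw; lia. Qed.

Lemma vertical_inc u v p q : x p = x q -> y p <> y q -> same_line x y u v p q ->
  exists p' q', [/\ x p' = x p, x p' = x q', y p' < y q' & same_line x y u v p' q'].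
Proof.
move=> e n sl; case: (Z.lt_ge_cases (y p) (y q)) => l; first by exists p, q.
by exists q, p; split; [lia|lia|lia|move=> s; rewrite sl collinear_sym].
Qed.

Lemma replaced_inc u v z w : fam u v -> y u < y v -> replaced u v z w -> inc_data u v z w.
Proof.
move=> f h [[nw fw] c]; split=> //; split=> //.
have a := fam_adj f; have [a1 _] := a.
have nw' := nw; rewrite (collinear_adj _ a h) /sw in nw'.
case: c => [[[p [q [e n lx sl]]] zu]|[nl cr zv]].
  left; have [p' [q' [ep' e' l' sl']]] := vertical_inc e n sl.
  rewrite -ep' in lx.
  have V := vleftP a h e' l' lx sl'; exists p', q'.
  by have [_ /(_ w)] := V; rewrite /sw => Vw; split => //; rewrite ?/strip in Vw *; lia.
right; split=> //.
  by move=> s; have := fw s; rewrite (collinear_adj _ a h) /sw; lia.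
case: cr => [[u' [v' [f' lt sl]]]|[p [q [e n lx sl]]]].
  left; exists u', v'; have B := blockP a h (fam_adj f') lt sl; split=> //.
  by have [_ /(_ w)] := B; have [a1' _] := fam_adj f'; case: B => -[? ? ?] _;
    rewrite /sw /corner; lia.
right; have [p' [q' [ep' e' l' sl']]] := vertical_inc e n sl.
rewrite -ep' in lx.
have V := vrightP a h e' l' lx sl'; exists p', q'.
by have [_ /(_ w)] := V; rewrite /sw /strip; split => //; lia.
Qed.

Lemma inc_inc u v z w u' v' z' w' : fam u v -> fam u' v' -> x u < x u' ->
  inc_data u v z w -> inc_data u' v' z' w' -> ~ same_line x y z w z' w'.
Proof.
move=> f f' lt [h [_ d]] [h' [_ d']].
have a := fam_adj f; have a' := fam_adj f'.
have [[a1 _] [a1' _]] := (a, a').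
case: d => [[p [q [-> V lw st]]]|[-> nl R [[b [b' [fb lb sl B cw]]]|[p [q [V lw st]]]]]];
case: d' => [[p' [q' [-> V' lw' st']]]|[-> nl' R' [[d [d' [fd ld sl' B' cw']]]|[p' [q' [V' lw'
  st']]]]]].
- exact: (vleft_vleft a h V lw st a' h' V' lw' st').
- exact: (vleft_block a h V lw st a' h' (fam_adj fd) B' cw' R').
- exact: (vleft_vright a h V lw st a' h' V' lw' st' R').
- move=> sz; apply: (block_vleft a' h' V' lw' st' a h (fam_adj fb) B cw) => //.
  + by move=> /(fam_fun f' fb)[].
  + move=> lp sl'; apply: nl; exists p', q'; case: V' => -[e ? l ?] _; split=> //; lia.
  + by move=> s; rewrite sz.
- apply: (block_block a h (fam_adj fb) B cw a' h' (fam_adj fd) B' cw' R') => //.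
  by move=> /(fam_fun f' fb)[].
- apply: (vright_block a h (fam_adj fb) B cw a' h' V' lw' st' R') => //.
  by move=> /(fam_fun f' fb)[].
- move=> sz; apply: (vright_vleft a' h' V' lw' st' a h V lw st) => // s; by rewrite sz.
- move=> sz; apply: (block_vright a' h' (fam_adj fd) B' cw' a h V lw st) => // s; by rewrite sz.
- exact: (vright_vright a h V lw st a' h').
Qed.

Lemma inc_plain u v z w a b : fam u v -> fam a b -> x u <> x a ->
  inc_data u v z w -> ~ same_line x y z w a b.
Proof.
move=> f fa ne [h [nw d]]; have au := fam_adj f; have aa := fam_adj fa.
case: d => [[p [q [-> V lw st]]]|[-> nl R [[c [c' [fc lc sl B cw]]]|[p [q [V lw st]]]]]].
- exact: (vleft_plain au h V lw st aa (not_eq_sym ne)).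
- case: (Z.eq_dec (x a) (x c)) => [e|n].
    (* Here [ab] is the later pair with the line of [uv], and that line misses [w]. *)
    have [-> ->] := fam_fun fa fc e.
    by move=> sl'; apply: nw; rewrite (sl w) -(sl' w); apply: collinear_refl2.
  exact: (block_plain au h (fam_adj fc) B cw aa (not_eq_sym ne) n).
- exact: (vright_plain au h V lw st aa (not_eq_sym ne)).
Qed.

Lemma inc_vertical u v z w p q : fam u v -> inc_data u v z w ->
  x p = x q -> y p <> y q -> ~ same_line x y z w p q.
Proof.
move=> f [h [nw d]] e n sl; have au := fam_adj f.
have [p' [q' [_ e' l' sl']]] := vertical_inc e n sl.
case: d => [[a [b [zu V lw st]]]|[zv nl R [[c [c' [fc lc slc B cw]]]|[a [b [V lw st]]]]]].
- by move: sl'; rewrite zu; apply: (vleft_vertical au h V lw st).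
- by move: sl'; rewrite zv; apply: (block_vertical au h (fam_adj fc) B cw).
- by move: sl'; rewrite zv; apply: (vright_vertical au h V lw st).
Qed.

Lemma inc_strict u v z w : fam u v -> inc_data u v z w -> strict_dec x y z w.
Proof.
move=> f [h [nw d]]; have [a1 _] := fam_adj f.
case: d => [[a [b [-> V lw st]]]|[-> nl R [[c [c' [fc lc slc B cw]]]|[a [b [V lw st]]]]]];
  rewrite /strict_dec.
- by case: V => -[? ? ? ?] _; rewrite /strip in st; lia.
- by case: B => -[? ? ?] _; have [b1 _] := fam_adj fc; rewrite /corner in cw; lia.
- by case: V => -[? ? ? ?] _; rewrite /strip in st; lia.
Qed.

End Family.

(** * Reflection in a horizontal axis, and the final choice of oblique lines *)

Section Reflection.
Variables (T : Type) (x y : T -> Z) (fam : T -> T -> Prop).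
Implicit Types (u v w p q s z : T).
Hypothesis fam_adj : forall u v, fam u v -> adj x y u v.
Hypothesis fam_fun : forall u v u' v', fam u v -> fam u' v' -> x u = x u' -> u = u' /\ v = v'.

Definition opp_coord (y : T -> Z) t := - y t.

Lemma collinear_opp : collinear x (opp_coord y) = collinear x y.
Proof.
apply/funext => u; apply/funext => v; apply/funext => w; apply/propext.
by rewrite /collinear /zbetw /opp_coord; lia.
Qed.

Lemma adj_opp u v : adj x y u v -> adj x (opp_coord y) u v.
Proof.
move=> [a1 [n a]]; rewrite /adj /opp_coord; split; [|split] => //; first by lia.
by move=> s; have := a s; lia.
Qed.

Lemma fam_adj_opp u v : fam u v -> adj x (opp_coord y) u v.
Proof. by move=> /fam_adj; apply: adj_opp. Qed.

Lemma replaced_opp u v z w : replaced x y fam u v z w -> replaced x (opp_coord y) fam u v z w.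
Proof.
have L : left_vertical x (opp_coord y) u v = left_vertical x y u v.
  apply/propext; rewrite /left_vertical /same_line collinear_opp /opp_coord;
    split=> -[p [q [? ? ? ?]]]; exists p, q; split=> //; lia.
have R : right_vertical x (opp_coord y) u v = right_vertical x y u v.
  apply/propext; rewrite /right_vertical /same_line collinear_opp /opp_coord;
    split=> -[p [q [? ? ? ?]]]; exists p, q; split=> //; lia.
by rewrite /replaced L R /farthest /collapsed /same_line collinear_opp.
Qed.

(** The two replacements have opposite slopes, so with equal lines they would be the diagonals of a
    rectangle. Its corners then contradict [ne] or the position patterns. *)
Lemma inc_opp u v z w u' v' z' w' : fam u v -> fam u' v' -> x u <> x u' ->
  inc_data x y fam u v z w -> inc_data x (opp_coord y) fam u' v' z' w' ->
  ~ same_line x y z w z' w'.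
Proof.
move=> f f' ne D D' sl.
have sd := inc_strict fam_adj f D.
have si : strict_inc x y z' w'.
  by have := inc_strict fam_adj_opp f' D'; rewrite /strict_dec /opp_coord /strict_inc; lia.
have r : rectangle_corners x y z' w' z w by apply: crossing_lines_corners => // s; rewrite sl.
rewrite /rectangle_corners in r.
have [a1 _] := fam_adj f; have [a1' _] := fam_adj f'.
case: D => h [_ d]; case: D' => h' [_ d']; rewrite /opp_coord in h'.
case: d => [[p [q [zu [[e lx lp lq] V] lw st]]]|[zv nl R [[b [b' [fb lb slb [[B1 B2 B3] B]
  cw]]]|[p [q [[[e lx lp lq] V] lw st]]]]]];
case: d' => [[p' [q' [zu' [[e' lx' lp' lq'] V'] lw' st']]]|[zv' nl' R' [[d [d' [fd ld sld [[B1'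
  B2' B3'] B'] cw']]]|[p' [q' [[[e' lx' lp' lq'] V'] lw' st']]]]]];
subst z z'.
- by lia.
- by have := B' u; have := B' w; have [d1 _] := fam_adj fd;
  rewrite /sw /corner /opp_coord in cw' B2' B3' *; lia.
- by have := V v'; rewrite /sw /strip; lia.
- by have := B u'; have := B w'; have [d1 _] := fam_adj fb; rewrite /sw /corner in cw *; lia.
- by have := B v'; have := B w'; have [d1 _] := fam_adj fb; rewrite /sw /corner in cw *; lia.
- by have := B v'; have := B w'; have [d1 _] := fam_adj fb; rewrite /sw /corner in cw *; lia.
- by have := V' v; rewrite /sw /strip /opp_coord in lq' *; lia.
- by have := B' v; have := B' w; have [d1 _] := fam_adj fd;
  rewrite /sw /corner /opp_coord in cw' B2' B3' *; lia.
- by lia.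
Qed.

Lemma inc_or_opp u v z w : fam u v -> replaced x y fam u v z w ->
  inc_data x y fam u v z w \/ inc_data x (opp_coord y) fam u v z w.
Proof.
move=> f r; have [_ [n _]] := fam_adj f.
case: (Z.lt_ge_cases (y u) (y v)) => h; [left|right].
  exact: replaced_inc.
by apply: (replaced_inc fam_adj_opp) => //; [rewrite /opp_coord; lia|apply: replaced_opp].
Qed.

Lemma replaced_neq u v z w u' v' z' w' : fam u v -> fam u' v' -> x u <> x u' ->
  replaced x y fam u v z w -> replaced x y fam u' v' z' w' -> ~ same_line x y z w z' w'.
Proof.
move=> + + + r r'; wlog lt : u v z w u' v' z' w' r r' / x u < x u'.
  move=> W f f' ne sl; case: (Z.lt_ge_cases (x u) (x u')) => h.
    exact: (W u v z w u' v' z' w').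
  by apply: (W u' v' z' w' u v z w) => // [||s]; [lia|lia|rewrite sl].
move=> f f' ne sl.
have [d|d] := inc_or_opp f r; have [d'|d'] := inc_or_opp f' r'.
- exact: (inc_inc fam_adj fam_fun f f' lt d d').
- exact: (inc_opp f f' ne d d').
- by apply: (inc_opp f' f (not_eq_sym ne) d' d) => s; rewrite sl.
- by apply: (inc_inc fam_adj_opp fam_fun f f' lt d d'); rewrite /same_line collinear_opp.
Qed.

Lemma replaced_plain u v z w a b : fam u v -> fam a b -> x u <> x a ->
  replaced x y fam u v z w -> ~ same_line x y z w a b.
Proof.
move=> f f' ne r; have [d|d] := inc_or_opp f r.
  exact: (inc_plain fam_adj fam_fun f f' ne d).
by have := inc_plain fam_adj_opp fam_fun f f' ne d; rewrite /same_line collinear_opp.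
Qed.

Lemma replaced_vertical u v z w p q : fam u v -> replaced x y fam u v z w ->
  x p = x q -> y p <> y q -> ~ same_line x y z w p q.
Proof.
move=> f r e n; have [d|d] := inc_or_opp f r.
  exact: (inc_vertical fam_adj f d e n).
have := inc_vertical fam_adj_opp f d e; rewrite /same_line collinear_opp; apply.
by rewrite /opp_coord; lia.
Qed.

Definition represents u v z w :=
  replaced x y fam u v z w \/
  [/\ ~ left_vertical x y u v, ~ (collapsed x y fam u v \/ right_vertical x y u v), z = u & w = v].

Lemma represents_neq u v z w u' v' z' w' : fam u v -> fam u' v' -> x u <> x u' ->
  represents u v z w -> represents u' v' z' w' -> ~ same_line x y z w z' w'.
Proof.
move=> f f' ne [r|[_ c -> ->]] [r'|[_ c' -> ->]].
- exact: replaced_neq r r'.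
- exact: replaced_plain r.
- by move=> sl; apply: (replaced_plain f' f (not_eq_sym ne) r') => s; rewrite sl.
(* Of two pairs with the same line, the left one is collapsed. *)
- move=> sl; case: (Z.lt_ge_cases (x u) (x u')) => h.
    by apply: c; left; exists u', v'.
  by apply: c'; left; exists u, v; split=> //; [lia|move=> s; rewrite sl].
Qed.

Lemma represents_vertical u v z w p q : fam u v -> represents u v z w ->
  x p = x q -> y p <> y q -> ~ same_line x y z w p q.
Proof.
move=> f [r|[nl c -> ->]] e n; first exact: replaced_vertical r e n.
move=> sl; have [a1 _] := fam_adj f; case: (Z.lt_ge_cases (x u) (x p)) => h.
  by apply: c; right; exists p, q; split=> //; lia.
by apply: nl; exists p, q.
Qed.

Lemma represents_diff u v z w : fam u v -> represents u v z w -> z <> w.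
Proof.
move=> f [r|[nl c -> ->]]; last by move=> e; have [] := fam_adj f; rewrite e; lia.
move=> e; have [d|d] := inc_or_opp f r.
  by have := inc_strict fam_adj f d; rewrite e /strict_dec; lia.
by have := inc_strict fam_adj_opp f d; rewrite e /strict_dec; lia.
Qed.

Lemma represents_exists u v : (exists w, farthest x y u v w) -> exists z w, represents u v z w.
Proof.
move=> [w fw]; have [l|nl] := EM (left_vertical x y u v).
  by exists u, w; left; split=> //; left.
have [c|nc] := EM (collapsed x y fam u v \/ right_vertical x y u v).
  by exists v, w; left; split=> //; right.
by exists u, v; right.
Qed.

End Reflection.

(** * Vertical pairs with the same line *)

Lemma vertical_inj (T : Type) (x y : T -> Z) p q p' q' :
  (forall p q, x p = x q -> y p = y q -> p = q) ->
  (forall p q, y p < y q -> exists r, y r = y p + 1) ->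
  (forall u v, u <> v -> exists w, ~ collinear x y u v w) ->
  x p = x q -> y p < y q -> x p' = x q' -> y p' < y q' -> same_line x y p q p' q' ->
  q = q' \/ forall s, (x s = x p \/ x s = x p') -> ~ y p < y s < y q /\ ~ y p' < y s < y q'.
Proof.
move=> inj gap NU; move: p q p' q'.
(* Points of one column at consecutive heights span a universal line, as the open strip between them
   is empty. *)
have U p r : x p = x r -> y r = y p + 1 -> False.
  move=> e e'; have [|w] := NU p r; first by move=> E; move: e'; rewrite E; lia.
  by rewrite /collinear /zbetw; lia.
(* If [p'] were higher than [p], a point in the strip of [pq], no higher than [p'], would be on one
   line only: the point [r] just above [p] or, for disjoint strips, any point off [pq]. *)
have eqa p q p' q' : x p = x q -> y p < y q -> x p' = x q' -> y p' < y q' ->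
  same_line x y p q p' q' -> y p' <= y p.
  move=> e l e' l' sl; case: (Z.lt_ge_cases (y p) (y p')) => // lt.
  have [r er] := gap _ _ l.
  have [|w] := NU p q; first by move=> E; move: l; rewrite E; lia.
  case: (Z.lt_ge_cases (y p') (y q)) => lt'; last first.
    by rewrite (sl w) => nw; exfalso; move: nw (sl w); rewrite !collinear_vert //; lia.
  by move=> _; have := sl r; rewrite !collinear_vert //; have := U p r; lia.
(* Otherwise [q] is inside the strip of [p'q'], hence in the column of [p']. A point [r] at the next
   height is then off [p'q'], unless [q'] has that height, which [U] excludes. *)
have eqb p q p' q' : x p = x q -> y p < y q -> x p' = x q' -> y p' < y q' ->
  same_line x y p q p' q' -> y p = y p' -> y q' <= y q.
  move=> e l e' l' sl ep; case: (Z.lt_ge_cases (y q) (y q')) => // lt.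
  have [r er] := gap _ _ lt.
  by have := sl q; have := sl r; rewrite !collinear_vert //; have := U q r; have := U q q'; lia.
move=> p q p' q' e l e' l' sl; have sl' : same_line x y p' q' p q by move=> s; rewrite sl.
have ep : y p = y p' by have := eqa _ _ _ _ e l e' l' sl; have := eqa _ _ _ _ e' l' e l sl'; lia.
have eq : y q = y q'.
  by have := eqb _ _ _ _ e l e' l' sl ep; have := eqb _ _ _ _ e' l' e l sl' (esym ep); lia.
(* The strips agree. In distinct columns, a point of either column inside the strip would be on
   exactly one of the lines. *)
case: (Z.eq_dec (x p) (x p')) => [E|N]; [left; apply: inj => //; lia|right].
by move=> s; have := sl s; rewrite !collinear_vert //; lia.
Qed.

Lemma exists_min (T : finType) (P : T -> Prop) (f : T -> Z) :
  (exists t, P t) -> exists2 t, P t & forall s, P s -> f t <= f s.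
Proof.
move=> [t0 Pt0].
suff [t [Pt m]] : exists t, P t /\ forall s, s \in enum T -> P s -> f t <= f s.
  by exists t => // s; apply: m; rewrite mem_enum.
elim: (enum T) => [|a l [t [Pt m]]]; first by exists t0.
have [[Pa lt]|n] := EM (P a /\ f a <= f t).
  exists a; split=> // s; rewrite inE => /predU1P[->|sl Ps]; first by lia.
  by have := m _ sl Ps; lia.
exists t; split=> // s; rewrite inE => /predU1P[-> Ps|]; last exact: m.
by case: (Z.lt_ge_cases (f t) (f a)) => h; [lia|case: n].
Qed.

(** * Counting the lines *)

Section Counting.
Variables (T : finType) (x y : T -> Z).
Implicit Types (p q r s u v : T).
Hypothesis inj : forall p q, x p = x q -> y p = y q -> p = q.
Hypothesis gapx : forall p q, x p < x q -> exists r, x r = x p + 1.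
Hypothesis gapy : forall p q, y p < y q -> exists r, y r = y p + 1.
Hypothesis no_universal : forall u v, u <> v -> exists w, ~ collinear x y u v w.

Lemma exists_adj p q : x p < x q -> exists u v, x u = x p /\ adj x y u v.
Proof.
move=> /gapx[r er].
have [|[u v] /= [eu ev] m] := @exists_min (T * T)%type
  (fun a => x a.1 = x p /\ x a.2 = x p + 1) (fun a => Z.abs (y a.1 - y a.2)).
  by exists (p, r).
(* Two points of equal height in consecutive columns span a universal line. *)
have row s t : x s = x p -> x t = x p + 1 -> y s <> y t.
  move=> es et e; have [|w] := no_universal (u := s) (v := t); first by move=> E; move: es;
    rewrite E; lia.
  by rewrite /collinear /zbetw; lia.
exists u, v; split=> //; split; first by lia.
split; first exact: row.
move=> s; have := row s v; have := row u s.
have := m (s, v); have := m (u, s) => /=; lia.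
Qed.

(** Each column is represented by its lowest point, so [rightward] stands for the pairs of
    consecutive columns. *)
Definition lowest := [set p | `[< forall q, x q = x p -> y p <= y q >]].
Definition rightward := [set p in lowest | `[< exists q, x p < x q >]].
Definition third := [set p | `[< exists q r, [/\ x q = x p, x r = x p & y q < y r < y p] >]].
Definition second := ~: lowest :\: third.

Lemma lowest_inj p q : p \in lowest -> q \in lowest -> x p = x q -> p = q.
Proof.
rewrite !inE => /asboolP hp /asboolP hq e; apply: inj => //.
by have := hp q; have := hq p; lia.
Qed.

Lemma exists_lowest p : exists2 q, q \in lowest & x q = x p.
Proof.
have [|q eq m] := @exists_min T (fun q => x q = x p) y; first by exists p.
by exists q => //; rewrite inE; apply/asboolP => r er; apply: m; rewrite er.
Qed.

Lemma card_rightward : (#|lowest| <= #|rightward|.+1)%N.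
Proof.
rewrite -(cardsID rightward lowest) (setIidPr _); last by apply/subsetP => p;
  rewrite inE => /andP[].
rewrite -addn1 leq_add2l; apply/card_le1_eqP => p q.
have last r s : r \in lowest :\: rightward -> x s <= x r.
  move=> /setDP[lr /negP nr]; case: (Z.lt_ge_cases (x r) (x s)) => // h.
  by case: nr; rewrite inE lr; apply/asboolP; exists s.
move=> hp hq; have [lp _] := setDP hp; have [lq _] := setDP hq; apply: lowest_inj => //.
by have := last _ q hp; have := last _ p hq; lia.
Qed.

(** Send each point to the lowest point of its column. Of two points of [second] in one column, the
    higher would have two points below it. *)
Lemma card_second : (#|second| <= #|lowest|)%N.
Proof.
have /choice[b hb] p : exists q, q \in lowest /\ x q = x p.
  by have [q] := exists_lowest p; exists q.
have injb : {in second &, injective b}.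
  move=> p q; rewrite !inE => /andP[/asboolP tp /asboolP lp] /andP[/asboolP tq /asboolP lq] e.
  have [lbp ebp] := hb p; have [_ ebq] := hb q; rewrite -e in ebq.
  apply: inj; first by lia.
  have above r : x r = x (b p) -> ~ (forall s, x s = x r -> y r <= y s) -> y (b p) < y r.
    move: lbp; rewrite inE => /asboolP m er nr.
    case: (Z.lt_ge_cases (y (b p)) (y r)) => // le; case: nr => s es.
    by have := m s; lia.
  have hp := above p (esym ebp) lp; have hq := above q (esym ebq) lq.
  case: (Z.lt_total (y p) (y q)) => [h|[//|h]]; exfalso.
    by apply: tq; exists (b p), p; split; lia.
  by apply: tp; exists (b p), q; split; lia.
rewrite -(card_in_imset injb); apply: subset_leq_card; apply/subsetP => _ /imsetP[p _ ->].
by have [] := hb p.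
Qed.

Definition rank_line u v := [set w | `[< collinear x y u v w >]].

Lemma rank_line_inj u v u' v' : rank_line u v = rank_line u' v' -> same_line x y u v u' v'.
Proof. by move=> /setP e s; have := e s; rewrite !inE => e';
  rewrite -(asboolE (collinear x y u v s)) e' asboolE. Qed.

Definition all_lines := [set rank_line p.1 p.2 | p in [set p : T * T | p.1 != p.2]].

Lemma exists_farthest u v : u <> v -> exists w, farthest x y u v w.
Proof.
move=> /no_universal ex.
have [|w nw m] := @exists_min T (fun w => ~ collinear x y u v w) (fun w => - x w) => //.
exists w; split=> // s; have [|/m] := EM (collinear x y u v s); [by left|right; lia].
Qed.

Lemma oblique_lines : exists2 A : {set {set T}}, A \subset all_lines /\ #|A| = #|rightward| &
  forall p q, x p = x q -> p <> q -> rank_line p q \notin A.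
Proof.
have [c hc] : exists c : T -> T * T, forall p, p \in rightward ->
  x (c p).1 = x p /\ adj x y (c p).1 (c p).2.
  suff /choice[c hc] p : exists a : T * T, p \in rightward -> x a.1 = x p /\ adj x y a.1 a.2
    by exists c.
  (* Outside [rightward] the value [(p, p)] is a default. *)
  have [|np] := boolP (p \in rightward); last by exists (p, p).
  rewrite inE => /andP[_ /asboolP[q /exists_adj[u [v uv]]]].
  by exists (u, v).
pose fam u v := exists2 p, p \in rightward & c p = (u, v).
have famc p : p \in rightward -> fam (c p).1 (c p).2 by exists p => //; case: (c p).
have fam_adj u v : fam u v -> adj x y u v.
  by move=> [p /hc[_ a] e]; rewrite e in a.
have fam_fun u v u' v' : fam u v -> fam u' v' -> x u = x u' -> u = u' /\ v = v'.
  move=> [p hp e] [p' hp' e'] xe.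
  have E : p = p'.
    apply: lowest_inj; [by move: hp; rewrite inE => /andP[]|by move: hp'; rewrite inE => /andP[]|].
    by have [<- _] := hc p hp; have [<- _] := hc p' hp'; rewrite e e'.
  by move: e'; rewrite -E e => -[].
have [m hm] : exists m : T -> T * T, forall p, p \in rightward ->
    represents x y fam (c p).1 (c p).2 (m p).1 (m p).2.
  suff /choice[m hm] p : exists a : T * T, p \in rightward ->
    represents x y fam (c p).1 (c p).2 a.1 a.2 by exists m.
  have [hp|np] := boolP (p \in rightward); last by exists (p, p).
  have [|z [w r]] := @represents_exists _ x y fam (c p).1 (c p).2; last by exists (z, w).
  apply: exists_farthest => e; have [_ []] := hc p hp; rewrite e; lia.
exists [set rank_line (m p).1 (m p).2 | p in rightward]; first split.
- apply/subsetP => _ /imsetP[p hp ->]; apply/imsetP; exists (m p) => //.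
  by rewrite inE; apply/eqP; apply: (represents_diff fam_adj (famc p hp) (hm p hp)).
- apply: card_in_imset => p q hp hq /rank_line_inj e.
  case: (Z.eq_dec (x (c p).1) (x (c q).1)) => [E|N].
    apply: lowest_inj; [by move: hp; rewrite inE => /andP[]|by move: hq; rewrite inE => /andP[]|].
    by have [<- _] := hc p hp; have [<- _] := hc q hq.
  by have := represents_neq fam_adj fam_fun (famc p hp) (famc q hq) N (hm p hp) (hm q hq) e.
move=> p q e n; apply/imsetP => -[r hr /rank_line_inj sl].
apply: (represents_vertical fam_adj (famc r hr) (hm r hr) e) => [E|s]; last by rewrite sl.
by apply: n; apply: inj.
Qed.

(** The condition on [Q] allows one point outside [third]. It rules out the exceptional case of
    [vertical_inj], because a third point has a point of its column strictly between it and the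
    lowest one. *)
Lemma vertical_lines (Q : {set T}) : {in Q, forall q, q \notin lowest} ->
  {in Q &, forall q q', q <> q' -> q \in third \/ q' \in third} ->
  exists2 B : {set {set T}}, B \subset all_lines /\ #|B| = #|Q| &
  forall L, L \in B -> exists p q, [/\ x p = x q, p <> q & L = rank_line p q].
Proof.
move=> nl th.
have /choice[b hb] p : exists q, q \in lowest /\ x q = x p.
  by have [q] := exists_lowest p; exists q.
have bq q : q \in Q -> b q <> q by move=> /nl + e; have [+ _] := hb q; rewrite e => ->.
have low q r : x r = x q -> y (b q) <= y r.
  by have [+ e1] := hb q; rewrite inE => /asboolP + e2; apply; rewrite e1.
have lt q : q \in Q -> y (b q) < y q.
  move=> /bq n; have := low q q erefl; have [_ e] := hb q.
  case: (Z.eq_dec (y (b q)) (y q)) => [E|]; last by lia.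
  by case: n; apply: inj.
exists [set rank_line (b q) q | q in Q]; first split.
- apply/subsetP => _ /imsetP[q hq ->]; apply/imsetP; exists (b q, q) => //.
  by rewrite inE; apply/eqP; apply: bq.
- apply: card_in_imset => q q' hq hq' /rank_line_inj sl.
  have [_ e] := hb q; have [_ e'] := hb q'.
  have [//|C] := vertical_inj inj gapy no_universal e (lt q hq) e' (lt q' hq') sl.
  have [//|N] := EM (q = q').
  case: (th q q' hq hq' N); rewrite inE => /asboolP[r [s [er es l]]]; exfalso.
    by have := low q r er; have := C s; lia.
  by have := low q' r er; have := C s; lia.
by move=> _ /imsetP[q hq ->]; exists (b q), q; split; [have [] := hb q|apply: bq|].
Qed.

Lemma card_all_lines : (1 < #|T|)%N -> (uphalf #|T| <= #|all_lines|)%N.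
Proof.
move=> T1; have [A [sA cA] vA] := oblique_lines.
have total : (#|T| <= #|lowest| + #|second| + #|third|)%N.
  rewrite -cardsT -(cardsID lowest setT) setTI setTD -addnA leq_add2l -(cardsID third) addnC
    leq_add2l.
  by apply: subset_leq_card; apply: subsetIr.
have bound (Q : {set T}) : {in Q, forall q, q \notin lowest} ->
    {in Q &, forall q q', q <> q' -> q \in third \/ q' \in third} ->
    (#|rightward| + #|Q| <= #|all_lines|)%N.
  move=> h1 h2; have [B [sB cB] vB] := vertical_lines h1 h2.
  rewrite -cA -cB -cardsUI (_ : A :&: B = set0) ?cards0 ?addn0.
    by apply: subset_leq_card; rewrite subUset sA.
  apply/setP => L; rewrite !inE; apply/negbTE/negP => /andP[LA /vB[p [q [e n E]]]].
  by have := vA p q e n; rewrite -E LA.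
have third_low q : q \in third -> q \notin lowest.
  rewrite !inE => /asboolP[r [s [er es l]]]; apply/negP => /asboolP /(_ r er); lia.
have rL := card_rightward; have sL := card_second.
have [E|/set0Pn[q0 q0S]] := eqVneq second set0.
  (* A point of minimal height among those not lowest cannot be third: the upper of two points below
     it would not be lowest either. *)
  have third0 : third = set0.
    apply/eqP/negP => /negP/set0Pn[t /third_low tl].
    have [|m ml mm] := @exists_min T (fun s => s \notin lowest) y; first by exists t.
    suff : m \in second by rewrite E inE.
    apply/setDP; split; first by rewrite inE.
    rewrite inE; apply/negP => /asboolP[r [s [er es l]]].
    suff /mm : s \notin lowest by lia.
    by rewrite inE; apply/negP => /asboolP /(_ r); lia.
  have := bound set0; rewrite E third0 !cards0 !addn0 in total * => b.
  have {}b : (#|rightward| <= #|all_lines|)%N by apply: b => q; rewrite inE.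
  have nL : (#|T| <= #|all_lines|.+1)%N by apply: leq_trans total (leq_trans rL _).
  (* With [m] lines and [n] points, [n <= m + 1] and [n > 1] give [m >= 1], hence [n <= 2 * m]. *)
  rewrite leq_uphalf_double -addnn (leq_trans nL) // -addn1 leq_add2l.
  by rewrite -ltnS (leq_trans T1 nL).
have [q0l q0t] : q0 \notin lowest /\ q0 \notin third by move: q0S => /setDP[]; rewrite inE.
have b : (#|rightward| + #|q0 |: third| <= #|all_lines|)%N.
  apply: bound => [q|q q']; first by move=> /setU1P[->|/third_low].
  by move=> /setU1P[->|?] /setU1P[->|?] // _; [right|left|left].
rewrite cardsU1 q0t add1n in b.
(* With [r] rightward and [t] third points, [n <= 2 * (r + 1) + t <= 2 * (r + t + 1)]. *)
rewrite leq_uphalf_double (leq_trans total) // (leq_trans (leq_add (leq_add rL (leq_trans sL rL))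
  (leqnn _))) //.
rewrite addnn; apply: leq_trans (_ : (#|rightward| + #|third|.+1).*2 <= _)%N;
  last by rewrite leq_double.
rewrite addnS -addSn doubleD leq_add2l -addnn; exact: leq_addr.
Qed.

End Counting.

(** * Ranks, and the passage from the L1 metric to them *)

Lemma exists_rank d (O : orderType d) (T : finType) (f : T -> O) :
  exists g : T -> Z, (forall p q, g p <= g q <-> (f p <= f q)%O) /\
    (forall p q, g p < g q -> exists r, g r = g p + 1).
Proof.
pose s := sort <=%O (undup (codom f)).
have ss : sorted <%O s by rewrite sort_lt_sorted undup_uniq.
have fs p : f p \in s by rewrite mem_sort mem_undup codom_f.
have lts p : (index (f p) s < size s)%N by rewrite index_mem.
exists (fun p => Z.of_nat (index (f p) s)); split=> p q.
  have := lt_sorted_leq_nth (f p) ss (lts p) (lts q); rewrite !nth_index // => ->.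
  by rewrite -Nat2Z.inj_le; split=> /ssrnat.leP.
rewrite -Nat2Z.inj_lt => /ssrnat.ltP lt.
have lt' : ((index (f p) s).+1 < size s)%N by apply: leq_ltn_trans lt (lts q).
(* Every entry of [s] is a value of [f], so the ranks have no gaps. *)
have := mem_nth (f p) lt'; rewrite mem_sort mem_undup => /codomP[r er].
by exists r; rewrite -er index_uniq ?(lt_sorted_uniq ss) //; lia.
Qed.

Local Close Scope Z_scope.
Local Open Scope fset_scope.
Local Open Scope ring_scope.

Definition betw (R : numDomainType) (a c b : R) := (a <= c <= b) || (b <= c <= a).

Lemma betwP (R : numDomainType) (T : Type) (f : T -> R) (g : T -> Z) :
  (forall p q, Z.le (g p) (g q) <-> f p <= f q) ->
  forall p q r, betw (f p) (f q) (f r) <-> zbetw (g p) (g q) (g r).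
Proof.
move=> m p q r; rewrite /zbetw !m /betw; split; first by move=> /orP[]/andP[]; [left|right].
by move=> [[-> ->]|[-> ->]]; rewrite ?orbT.
Qed.

Lemma l1dist_between (R : realType) (p q r : R * R) :
  (l1dist p q == l1dist p r + l1dist r q) = betw p.1 r.1 q.1 && betw p.2 r.2 q.2.
Proof.
(* The triangle inequality holds in each coordinate, so equality of the sums means equality in
   both. *)
have tri (a b c : R) : `|a - b| <= `|a - c| + `|c - b| ?= iff betw a c b.
  rewrite /betw; split; first by rewrite -{1}(subrK c a) -addrA ler_normD.
  case: (lerP a b); case: (lerP a c); case: (lerP c b) => h1 h2 h3;
  rewrite ?(ger0_norm, ltr0_norm, ler0_norm, gtr0_norm) ?subr_ge0 ?subr_le0 ?subr_gt0 ?subr_lt0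
    //=; try lra.
rewrite /l1dist addrACA.
by have [_ ->] := leifD (tri p.1 q.1 r.1) (tri p.2 q.2 r.2).
Qed.

Lemma in_lineE (R : realType) (X : {fset R * R}) (u v w : R * R) : w \in X -> u != v ->
  (w \in line X u v) = let B p q r := betw p.1 q.1 r.1 && betw p.2 q.2 r.2 in
    [|| B u w v, B u v w | B v u w].
Proof.
move=> wX uv; rewrite !inE wX /= /between !l1dist_between uv (eq_sym v u) uv /=.
(* Weak betweenness absorbs the cases [w = u] and [w = v], which [line] lists separately. *)
have tot (a b : R) : betw a a b /\ betw a b b by split; rewrite /betw !lexx /= ?andbT le_total.
have [->|wu] := eqVneq w u; first by rewrite !(tot _ _).1.
have [->|wv] := eqVneq w v; first by rewrite !(tot _ _).2.
by rewrite /= (orbC (betw v.1 _ _ && _)).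
Qed.

Theorem theorem1 (R : realType) (n : nat) (hn : (2 <= n)%N)
    (X : {fset R * R}) (hX : #|` X| = n)
    (no_universal : ~ exists u v : R * R,
       [/\ u \in X, v \in X, u <> v & line X u v = X]) :
  (uphalf n <= #|` lines X|)%N.
Proof.
have [x [xm gx]] := exists_rank (fun t : X => (val t).1).
have [y [ym gy]] := exists_rank (fun t : X => (val t).2).
have onE (u v w : X) : u != v -> (val w \in line X (val u) (val v)) = `[< collinear x y u v w >].
  move=> uv; rewrite in_lineE ?fsvalP //=; apply/idP/asboolP;
    rewrite /collinear -!(betwP xm) -!(betwP ym).
    by move=> /or3P[]/andP[]; [left|right; left|right; right].
  by move=> [[-> ->]//|[[-> ->]|[-> ->]]]; rewrite ?orbT.
have inj (p q : X) : x p = x q -> y p = y q -> p = q.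
  move=> ex ey; apply: val_inj; apply/eqP; rewrite -pair_eqE; apply/andP.
  by split; rewrite eq_le; apply/andP; split; [apply/xm|apply/xm|apply/ym|apply/ym];
    rewrite ?ex ?ey; apply: Z.le_refl.
have nu (u v : X) : u <> v -> exists w, ~ collinear x y u v w.
  move=> /eqP uv; apply: contrapT => all; apply: no_universal; exists (val u), (val v); split;
    rewrite ?fsvalP //.
    by move=> /val_inj /eqP; apply/negP.
  apply/fsetP => w; apply/idP/idP => [|wX]; first by rewrite inE => /andP[].
  rewrite (onE _ _ [` wX]) //; apply/asboolP; apply: contrapT => nw; apply: all.
  by exists [` wX].
rewrite -hX cardfE; rewrite -hX cardfE in hn.
apply: leq_trans (card_all_lines inj gx gy nu hn) _.
(* Each line in ranks is the trace of a member of [lines X] on the finite type of points of [X]. *)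
have sub : all_lines x y \subset [set fsub X (val L) | L : lines X].
  apply/subsetP => L /imsetP[[u v] /=]; rewrite inE /= => uv ->.
  have lX : line X (val u) (val v) \in lines X.
    apply/imfsetP; exists (val u, val v) => //=.
    by rewrite !inE /= !fsvalP /=; apply: contra uv => /eqP/val_inj->.
  apply/imsetP; exists [` lX] => //=.
  by apply/setP => t; rewrite in_fsub onE // inE.
by rewrite (leq_trans (subset_leq_card sub)) // (leq_trans (leq_imset_card _ _)) // -cardfE.
Qed.
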